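(* Let $p$ be a prime and let $X$ be an irretractable cycle set of size $p^k$ whose displacement group acts regularly on $X$. Then $\mathcal{G}(X)$ is isomorphic, as a left brace, to a semidirect product of $B_p$ and $C_n$, where $B_p$ is the $p$-Sylow subgroup of $(\mathcal{G}(X),+)$, $C_n$ is a trivial cyclic left brace of order $n$, and $\gcd(n,p)=1$.
   Context: A left quasigroup $(X,\cdot)$ is a non-empty set with a binary operation such that $\sigma_x:y\mapsto x\cdot y$ is bijective for every $x$. A cycle set is a left quasigroup with $(x\cdot y)\cdot(x\cdot z)=(y\cdot x)\cdot(y\cdot z)$ for all $x,y,z$; all cycle sets are assumed non-degenerate, i.e. $x\mapsto x\cdot x$ is bijective. $X$ is irretractable if $\sigma_x=\sigma_y$ implies $x=y$. $\mathcal{G}(X)=\langle\sigma_x\mid x\in X\rangle\le \mathrm{Sym}(X)$; the displacement group is the normal closure of $\{\sigma_x\sigma_y^{-1}\mid x,y\in X\}$ in $\mathcal{G}(X)$. A left brace is a set $B$ with an abelian group $(B,+)$ and a group $(B,\circ)$ such that $x\circ(y+z)+x=x\circ y+x\circ z$; put $\lambda_x(y):=-x+x\circ y$. For a cycle set $X$, $\mathcal{G}(X)$ carries its standard left brace structure: $\circ$ is composition and $+$ is the unique operation making $\mathcal{G}(X)$ a left brace with $(\mathcal{G}(X),+)$ generated by $\{\sigma_x^{-1}\mid x\in X\}$ and $\lambda_g(\sigma_x^{-1})=\sigma_{g(x)}^{-1}$ for all $g\in\mathcal{G}(X)$, $x\in X$. The Sylow subgroups of $(B,+)$ of a finite left brace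 $B$ are closed under $\circ$ and are themselves left braces. A trivial left brace is one with $x\circ y=x+y$; it is cyclic if its group is cyclic. Given left braces $B,C$ and a homomorphism $\alpha:(C,\circ)\to\mathrm{Aut}(B,+,\circ)$, the semidirect product $B\rtimes_\alpha C$ is $B\times C$ with $(b,c)+(b',c')=(b+b',c+c')$ and $(b,c)\circ(b',c')=(b\circ\alpha_c(b'),c\circ c')$. *)

(* Defs.v *)
From HB Require Import structures.
From mathcomp Require Import all_boot all_order all_fingroup all_algebra all_solvable.

Set Implicit Arguments.
Unset Strict Implicit.
Unset Printing Implicit Defensive.

Import GroupScope GRing.Theory.

HB.mixin Record isCycleSet X of Finite X := {
  cdot : X -> X -> X;
  cycle_inhabited : inhabited X;
  cdot_bij : forall x, bijective (cdot x);
  cdot_cycle : forall x y z,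
    cdot (cdot x y) (cdot x z) = cdot (cdot y x) (cdot y z);
  cdot_nondegenerate : bijective (fun x => cdot x x)
}.

#[short(type="finCycleSetType")]
HB.structure Definition FinCycleSet := {X of isCycleSet X & Finite X}.

(* In [{perm X}] the product [h * g] maps [x] to [g (h x)]; [pcomp g h] is the
   usual composition, mapping [x] to [g (h x)]. *)
Definition pcomp (X : finType) (g h : {perm X}) : {perm X} := h * g.

Section CycleSetGroups.
Variable X : finCycleSetType.

Definition csigma (x : X) : {perm X} := perm (bij_inj (cdot_bij x)).

Definition irretractable : Prop := injective csigma.

Definition perm_group : {group {perm X}} := <<[set csigma x | x : X]>>%G.

Definition dis_gens : {set {perm X}} :=
  [set pcomp (csigma x) (csigma y)^-1 | x : X, y : X].

(* [class_support A G] is the set of all conjugates of elements of [A] by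
   elements of [G], so this is the normal closure of [dis_gens] in
   [perm_group]. *)
Definition dis_group : {group {perm X}} :=
  <<class_support dis_gens perm_group>>%G.

End CycleSetGroups.

Definition acts_regularly (X : finType) (D : {group {perm X}}) : Prop :=
  [transitive D, on [set: X] | 'P] /\ forall x : X, 'C_D[x | 'P] = 1.

HB.mixin Record Zmodule_isLeftBrace B of GRing.Zmodule B := {
  circ : B -> B -> B;
  circ_one : B;
  circ_inv : B -> B;
  circA : associative circ;
  circ1b : left_id circ_one circ;
  circVb : left_inverse circ_one circ_inv circ;
  circD : forall x y z : B, (circ x (y + z) + x = circ x y + circ x z)%R
}.

#[short(type="leftBraceType")]
HB.structure Definition LeftBrace :=
  {B of Zmodule_isLeftBrace B & GRing.Zmodule B}.

#[short(type="finLeftBraceType")]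
HB.structure Definition FinLeftBrace := {B of LeftBrace B & Finite B}.

(* As for the finite structures of [finalg], the [finGroupType] attached to a
   finite left brace is its additive group. *)
#[non_forgetful_inheritance]
HB.instance Definition _ (B : finLeftBraceType) := [finGroupMixin of B for +%R].
Coercion finLeftBrace_to_finGroup (B : finLeftBraceType) : finGroupType :=
  FinGroup.clone (B : Type) _.

Definition blambda (B : leftBraceType) (x y : B) : B := (- x + circ x y)%R.

Definition trivial_brace (B : leftBraceType) : Prop :=
  forall x y : B, circ x y = (x + y)%R.

Definition cyclic_trivial_brace (B : finLeftBraceType) : Prop :=
  trivial_brace B /\ cyclic [set: B].

Definition brace_morph (B C : leftBraceType) (f : B -> C) : Prop :=
  (forall x y, f (x + y)%R = (f x + f y)%R) /\
  (forall x y, f (circ x y) = circ (f x) (f y)).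

Definition brace_isog (B C : leftBraceType) : Prop :=
  exists2 f : B -> C, bijective f & brace_morph f.

Section LeftBraceTheory.
Variable B : leftBraceType.
Implicit Types x y z : B.

Lemma circ_injl x : injective (circ x).
Proof.
move=> y z e; rewrite -(circ1b y) -(circ1b z) -(circVb x).
by rewrite -!circA e.
Qed.

Lemma circb1 x : circ x circ_one = x.
Proof.
by apply: (@circ_injl (circ_inv x)); rewrite circA circVb circ1b.
Qed.

Lemma circbV x : circ x (circ_inv x) = circ_one.
Proof.
apply: (@circ_injl (circ_inv x)).
by rewrite circA circVb circ1b circb1.
Qed.

Lemma circ_lambda x y : circ x y = (x + blambda x y)%R.
Proof. by rewrite /blambda addrA subrr add0r. Qed.

Lemma circ_one0 : circ_one = 0%R :> B.
Proof.
have := circD circ_one (0 : B)%R 0%R.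
by rewrite !circ1b !add0r.
Qed.

Lemma blambdaD x y z : blambda x (y + z)%R = (blambda x y + blambda x z)%R.
Proof.
rewrite /blambda.
have /(canRL (addrK x)) -> := circD x y z.
by rewrite -addrA [(circ x z - x)%R]addrC addrA.
Qed.

Lemma circ_inv_lambda x : circ_inv x = (- blambda (circ_inv x) x)%R.
Proof.
by rewrite /blambda circVb circ_one0 addr0 opprK.
Qed.

End LeftBraceTheory.

Section SylowBrace.
Variables (B : finLeftBraceType) (p : nat) (P : {group B}).
Hypothesis sylP : p.-Sylow([set: B]) P.

Lemma mem_addSylow (x : B) : (x \in P) = p.-elt (x : B).
Proof.
have abB : abelian [set: B].
  by apply/centsP=> x1 _ x2 _; apply: addrC.
have nsP : P <| [set: B] by rewrite -sub_abelian_normal ?subsetT.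
by rewrite (mem_normal_Hall sylP nsP) ?inE.
Qed.

Lemma lambda_addSylow (x y : B) : y \in P -> blambda x y \in P.
Proof.
have lamM : {in [set: B] &, {morph (blambda x : B -> B) : y z / (y * z)%g}}.
  by move=> y1 y2 _ _; apply: blambdaD.
rewrite !mem_addSylow => yp.
by apply: (morph_p_elt (Morphism lamM)); rewrite ?inE.
Qed.

Lemma circ_addSylow (x y : B) : x \in P -> y \in P -> circ x y \in P.
Proof.
by move=> xP yP; rewrite circ_lambda (groupM xP) ?lambda_addSylow.
Qed.

Lemma circ_one_addSylow : (circ_one : B) \in P.
Proof. by rewrite circ_one0 group1. Qed.

Lemma circ_inv_addSylow (x : B) : x \in P -> circ_inv x \in P.
Proof.
by move=> xP; rewrite circ_inv_lambda (groupVr (lambda_addSylow _ xP)).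
Qed.

(* [subg_of P] is the subtype of the elements of [P]; the argument [sylP] is
   needed because only Sylow subgroups are closed under [circ]. *)
Definition sylow_brace_type of p.-Sylow([set: B]) P : Type := subg_of P.
Local Notation S := (sylow_brace_type sylP).

HB.instance Definition _ := SubFinite.copy S (subg_of P).

Definition sylow_add (x y : S) : S := Subg (groupM (valP x) (valP y)).
Definition sylow_zero : S := Subg (group1 P).
Definition sylow_opp (x : S) : S := Subg (groupVr (valP x)).
Definition sylow_circ (x y : S) : S := Subg (circ_addSylow (valP x) (valP y)).
Definition sylow_one : S := Subg circ_one_addSylow.
Definition sylow_inv (x : S) : S := Subg (circ_inv_addSylow (valP x)).

Fact sylow_addA : associative sylow_add.
Proof. by move=> x y z; apply: val_inj; apply: addrA. Qed.
Fact sylow_addC : commutative sylow_add.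
Proof. by move=> x y; apply: val_inj; apply: addrC. Qed.
Fact sylow_add0 : left_id sylow_zero sylow_add.
Proof. by move=> x; apply: val_inj; apply: add0r. Qed.
Fact sylow_addN : left_inverse sylow_zero sylow_opp sylow_add.
Proof. by move=> x; apply: val_inj; apply: addNr. Qed.

HB.instance Definition _ :=
  GRing.isZmodule.Build S sylow_addA sylow_addC sylow_add0 sylow_addN.

Fact sylow_circA : associative sylow_circ.
Proof. by move=> x y z; apply: val_inj; apply: circA. Qed.
Fact sylow_circ1 : left_id sylow_one sylow_circ.
Proof. by move=> x; apply: val_inj; apply: circ1b. Qed.
Fact sylow_circV : left_inverse sylow_one sylow_inv sylow_circ.
Proof. by move=> x; apply: val_inj; apply: circVb. Qed.
Fact sylow_circD (x y z : S) :
  (sylow_circ x (y + z) + x = sylow_circ x y + sylow_circ x z)%R.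
Proof. by apply: val_inj; apply: circD. Qed.

HB.instance Definition _ := Zmodule_isLeftBrace.Build S
  sylow_circA sylow_circ1 sylow_circV sylow_circD.

Definition sylow_brace : finLeftBraceType := S.

End SylowBrace.

(* Homomorphisms from [(C, circ)] to [Aut(B, +, circ)]. *)
Record brace_action (C B : leftBraceType) := BraceAction {
  bact :> C -> B -> B;
  bact_bij : forall c, bijective (bact c);
  bact_morph : forall c, brace_morph (bact c);
  bact_circ : forall c d b, bact (circ c d) b = bact c (bact d b)
}.

Section Semidirect.
Variables (B C : leftBraceType) (alpha : brace_action C B).

Definition sdbrace_type of brace_action C B : Type := (B * C)%type.
Local Notation S := (sdbrace_type alpha).

HB.instance Definition _ := GRing.Zmodule.copy S (B * C)%type.

Definition sd_circ (x y : S) : S :=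
  (circ x.1 (alpha x.2 y.1), circ x.2 y.2).
Definition sd_one : S := (circ_one, circ_one).
Definition sd_inv (x : S) : S :=
  (alpha (circ_inv x.2) (circ_inv x.1), circ_inv x.2).

Fact bact1 b : alpha circ_one b = b.
Proof.
apply: (bij_inj (bact_bij alpha circ_one)).
by rewrite -bact_circ circ1b.
Qed.

Fact bact_one c : alpha c circ_one = circ_one.
Proof.
apply: (@circ_injl _ (alpha c circ_one)).
by rewrite -(bact_morph alpha c).2 circ1b circb1.
Qed.

Fact sd_circA : associative sd_circ.
Proof.
move=> [b c] [b' c'] [b'' c'']; rewrite /sd_circ /=.
by rewrite (bact_morph alpha c).2 -bact_circ !circA.
Qed.
Fact sd_circ1 : left_id sd_one sd_circ.
Proof. by move=> [b c]; rewrite /sd_circ /= bact1 !circ1b. Qed.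
Fact sd_circV : left_inverse sd_one sd_inv sd_circ.
Proof.
move=> [b c]; rewrite /sd_circ /sd_inv /=.
by rewrite -(bact_morph alpha _).2 !circVb bact_one.
Qed.
Fact sd_circD (x y z : S) :
  (sd_circ x (y + z) + x = sd_circ x y + sd_circ x z)%R.
Proof.
case: x y z => [b c] [b' c'] [b'' c'']; congr (_, _); rewrite /= ?circD //.
by rewrite (bact_morph alpha c).1 circD.
Qed.

HB.instance Definition _ := Zmodule_isLeftBrace.Build S
  sd_circA sd_circ1 sd_circV sd_circD.

Definition sdbrace : leftBraceType := S.

End Semidirect.

Section StandardBrace.
Variable X : finCycleSetType.
Local Notation sigma := (@csigma X).
Local Notation G := (perm_group X).

Lemma csigmaE x y : sigma x y = cdot x y. Proof. exact: permE. Qed.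

Lemma csigma_cycle x y :
  sigma y * sigma (cdot y x) = sigma x * sigma (cdot x y).
Proof. by apply/permP=> z; rewrite !permM !csigmaE cdot_cycle. Qed.

(* [strans x] is the translation [g |-> g + (sigma x)^-1], which by the
   required formula for [lambda] is the composition of [g] with the inverse of
   [sigma (g^-1 x)]. The translations commute and generate an abelian group
   which is transitive on [perm_group X]; the sum of [g] and [h] is the image
   of [g] under the element of that group that maps [1] to [h]. *)
Definition strans_fun (x : X) (g : {perm X}) : {perm X} :=
  pcomp g (sigma (g^-1 x))^-1.

Fact strans_inj x : injective (strans_fun x).
Proof.
move=> g h; rewrite /strans_fun /pcomp.
set u := g^-1 x; set v := h^-1 x => e.
have gu : g u = x by rewrite /u -permM mulVg perm1.
have hv : h v = x by rewrite /v -permM mulVg perm1.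
have euv : sigma u u = sigma v v.
  apply: (can_inj (permK (sigma v)^-1)); apply: (can_inj (permK h)).
  rewrite -[LHS]permM -e permM permK gu.
  by rewrite permK hv.
have uv : u = v.
  by apply: (bij_inj (@cdot_nondegenerate X)); rewrite -!csigmaE.
by move: e; rewrite uv => /mulgI.
Qed.

Definition strans x : {perm {perm X}} := perm (@strans_inj x).
Definition strans_group : {group {perm {perm X}}} :=
  <<[set strans x | x : X]>>%G.
Local Notation A := strans_group.

Definition std_tr (h : {perm X}) : {perm {perm X}} :=
  odflt 1 [pick a in A | a 1 == h].
Definition std_add (g h : {perm X}) : {perm X} := std_tr h g.
Definition std_opp (g : {perm X}) : {perm X} := (std_tr g)^-1 1.

Lemma stransE x g : strans x g = (sigma (g^-1 x))^-1 * g.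
Proof. by rewrite permE. Qed.

Lemma strans_in x : strans x \in A.
Proof. by apply: mem_gen; apply: imset_f. Qed.

Lemma csigma_in x : sigma x \in G.
Proof. by apply: mem_gen; apply: imset_f. Qed.

Lemma strans_abelian : abelian A.
Proof.
rewrite abelian_gen; apply/centsP=> _ /imsetP[x _ ->] _ /imsetP[y _ ->].
apply/permP=> g; rewrite !permM !stransE !mulgA -!invMg.
rewrite !invMg !invgK !permM.
set u := g^-1 x; set v := g^-1 y.
congr (_ * _); rewrite -!invMg; congr (_^-1).
by rewrite !csigmaE csigma_cycle.
Qed.

Lemma strans_comm a b g : a \in A -> b \in A -> a (b g) = b (a g).
Proof.
move=> aA bA; rewrite -!permM.
by have /centsP/(_ _ bA _ aA) -> := strans_abelian.
Qed.

Lemma strans_stab a g : a \in A -> g \in G -> a g \in G.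
Proof.
have sA : A \subset 'N(G | 'P).
  rewrite gen_subG; apply/subsetP=> _ /imsetP[x _ ->].
  rewrite !inE /=; apply/subsetP=> h hG; rewrite inE /= /aperm stransE.
  by rewrite groupM ?groupV ?csigma_in.
by move=> /(subsetP sA) aN gG; have := astabs_act g aN; rewrite /= gG.
Qed.

Lemma strans_trans g : g \in G -> exists2 a, a \in A & a 1 = g.
Proof.
case/gen_prodgP=> n [c cS ->].
elim: n => [|n IHn] in c cS *.
  by exists 1; rewrite ?group1 // big_ord0 perm1.
have [a aA ea] := IHn (fun i => c (lift ord0 i)) (fun i => cS _).
rewrite big_ord_recl; have /imsetP[y _ ->] := cS ord0.
rewrite -ea; set g0 := a 1.
exists (a * (strans (g0 (sigma y y)))^-1); first by rewrite groupM ?groupV ?strans_in.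
rewrite permM -/g0; apply: (can_inj (permK (strans (g0 (sigma y y))))).
rewrite permKV stransE invMg permM permK permK.
by rewrite mulKg.
Qed.

Lemma std_trP h : h \in G -> std_tr h \in A /\ std_tr h 1 = h.
Proof.
move=> /strans_trans[a aA ea]; rewrite /std_tr.
case: pickP => [b /andP[bA /eqP] // | /(_ a)].
by rewrite aA ea eqxx.
Qed.

Lemma std_tr_uniq a g : a \in A -> g \in G -> std_add g (a 1) = a g.
Proof.
move=> aA /strans_trans[c cA <-].
have [bA eb] := std_trP (strans_stab aA (group1 G)).
by rewrite /std_add strans_comm // eb strans_comm.
Qed.

Lemma std_add_in g h : g \in G -> h \in G -> std_add g h \in G.
Proof. by move=> gG /std_trP[aA _]; apply: strans_stab. Qed.

Lemma std_opp_in g : g \in G -> std_opp g \in G.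
Proof. by move=> /std_trP[aA _]; apply: strans_stab; rewrite ?groupV ?group1. Qed.

Lemma std_addC g h : g \in G -> h \in G -> std_add g h = std_add h g.
Proof.
move=> /std_trP[aA ea] /std_trP[bA eb].
by rewrite /std_add -{1}ea strans_comm // eb.
Qed.

Lemma std_addA f g h : f \in G -> g \in G -> h \in G ->
  std_add f (std_add g h) = std_add (std_add f g) h.
Proof.
move=> fG /std_trP[aA ea] /std_trP[bA eb].
have abA : std_tr g * std_tr h \in A by rewrite groupM.
by have := std_tr_uniq abA fG; rewrite !permM ea.
Qed.

Lemma std_add0 g : g \in G -> std_add 1 g = g.
Proof. by case/std_trP. Qed.

Lemma std_addN g : std_add (std_opp g) g = 1.
Proof. by rewrite /std_add /std_opp permKV. Qed.

Lemma strans_pcomp g a : a \in A ->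
  exists2 a', a' \in A & forall f, pcomp g (a f) = a' (pcomp g f).
Proof.
case/gen_prodgP=> n [c cS ->].
elim: n => [|n IHn] in c cS *.
  by exists 1 => [|f]; rewrite ?group1 // big_ord0 !perm1.
have [a' aA ea] := IHn (fun i => c (lift ord0 i)) (fun i => cS _).
rewrite big_ord_recl; have /imsetP[y _ ->] := cS ord0.
exists (strans (g y) * a') => [|f]; first by rewrite groupM ?strans_in.
rewrite !permM ea; congr (a' _).
by rewrite !stransE /pcomp invMg permM permK mulgA.
Qed.

Lemma std_circD g h k : g \in G -> h \in G -> k \in G ->
  std_add (pcomp g (std_add h k)) g = std_add (pcomp g h) (pcomp g k).
Proof.
move=> gG hG kG; have [aA ea] := std_trP kG.
have [a' a'A e'] := strans_pcomp g aA.
have ghG : pcomp g h \in G by rewrite groupM.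
have [bA eb] := std_trP gG.
have -> : pcomp g k = a' g by rewrite -[in LHS]ea e' /pcomp mul1g.
rewrite {2}/std_add e' (std_addC ghG) ?strans_stab //.
have [cA _] := std_trP ghG.
rewrite /std_add strans_comm // [RHS]strans_comm //; congr (a' _).
exact: std_addC.
Qed.

Definition std_brace_type : Type := subg_of G.
Local Notation T := std_brace_type.

HB.instance Definition _ := SubFinite.copy T (subg_of G).

Definition sb_add (g h : T) : T := Subg (std_add_in (valP g) (valP h)).
Definition sb_zero : T := Subg (group1 G).
Definition sb_opp (g : T) : T := Subg (std_opp_in (valP g)).
Definition sb_circ (g h : T) : T :=
  Subg (groupM (valP h) (valP g) : pcomp (val g) (val h) \in G).
Definition sb_inv (g : T) : T := Subg (groupVr (valP g)).

Fact sb_addA : associative sb_add.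
Proof. by move=> f g h; apply: val_inj; apply: std_addA; apply: valP. Qed.
Fact sb_addC : commutative sb_add.
Proof. by move=> g h; apply: val_inj; apply: std_addC; apply: valP. Qed.
Fact sb_add0 : left_id sb_zero sb_add.
Proof. by move=> g; apply: val_inj; apply: std_add0; apply: valP. Qed.
Fact sb_addN : left_inverse sb_zero sb_opp sb_add.
Proof. by move=> g; apply: val_inj; apply: std_addN. Qed.

HB.instance Definition _ :=
  GRing.isZmodule.Build T sb_addA sb_addC sb_add0 sb_addN.

Fact sb_circA : associative sb_circ.
Proof. by move=> f g h; apply: val_inj; rewrite /= /pcomp mulgA. Qed.
Fact sb_circ1 : left_id sb_zero sb_circ.
Proof. by move=> g; apply: val_inj; rewrite /= /pcomp mulg1. Qed.
Fact sb_circV : left_inverse sb_zero sb_inv sb_circ.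
Proof. by move=> g; apply: val_inj; rewrite /= /pcomp mulgV. Qed.
Fact sb_circD (f g h : T) :
  (sb_circ f (g + h) + f = sb_circ f g + sb_circ f h)%R.
Proof. by apply: val_inj; apply: std_circD; apply: valP. Qed.

HB.instance Definition _ := Zmodule_isLeftBrace.Build T
  sb_circA sb_circ1 sb_circV sb_circD.

Definition std_brace : finLeftBraceType := T.

Definition std_val (g : std_brace) : {perm X} := sgval (g : subg_of G).

Definition std_gen (x : X) : std_brace :=
  Subg (groupVr (csigma_in x)) : subg_of G.

Lemma std_val_inj : injective std_val.
Proof. exact: val_inj. Qed.

Lemma std_val_codom (g : {perm X}) :
  reflect (exists h, std_val h = g) (g \in G).
Proof.
apply: (iffP idP) => [gG | [h <-]]; last exact: subgP.
by exists (Subg gG : subg_of G).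
Qed.

Lemma std_val_gen x : std_val (std_gen x) = (sigma x)^-1.
Proof. by []. Qed.

Lemma std_val_circ (g h : std_brace) :
  std_val (circ g h) = pcomp (std_val g) (std_val h).
Proof. by []. Qed.

Lemma std_add_gen (g : std_brace) x :
  (g + std_gen x)%R = circ g (std_gen ((std_val g)^-1 x)).
Proof.
apply: val_inj; rewrite /= /pcomp -[in LHS](mulg1 (sigma x)^-1).
have := std_tr_uniq (strans_in x) (valP g); rewrite !stransE.
by rewrite invg1 perm1 => ->.
Qed.

Lemma std_lambda (g : std_brace) x :
  blambda g (std_gen x) = std_gen (std_val g x).
Proof.
apply: (addrI g); rewrite -circ_lambda std_add_gen.
by rewrite permK.
Qed.

Lemma std_generated : <<[set std_gen x | x : X]>> = [set: std_brace].
Proof.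
apply/eqP; rewrite eqEsubset subsetT /=; apply/subsetP=> g _.
set H := <<_>>.
have sH : A \subset 'N([set std_val h | h in H] | 'P).
  rewrite gen_subG; apply/subsetP=> _ /imsetP[x _ ->].
  rewrite !inE /=; apply/subsetP=> _ /imsetP[h hH ->]; rewrite inE /= /aperm.
  apply/imsetP; exists (h + std_gen x)%R.
    by apply: groupM => //; apply: mem_gen; apply: imset_f.
  by rewrite std_add_gen stransE.
have [a aA ea] := strans_trans (valP g).
have := astabs_act 1 (subsetP sH _ aA).
rewrite /= /aperm ea => e.
have : (1 : {perm X}) \in [set std_val h | h in H].
  by apply/imsetP; exists 0%R => //; apply: group1.
by rewrite -e => /imsetP[h hH /std_val_inj ->].
Qed.

End StandardBrace.

(* [std_brace X] is the only left brace with multiplicative group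
   [perm_group X] in which the [(sigma x)^-1] generate the additive group and
   [lambda] acts on them as required. *)
Lemma std_brace_unique (X : finCycleSetType) (B : finLeftBraceType)
    (f : B -> std_brace X) (s : X -> B) :
    {morph f : x y / circ x y} ->
    (forall x, f (s x) = std_gen x) ->
    <<[set s x | x : X]>> = [set: B] ->
    (forall b x, blambda b (s x) = s (std_val (f b) x)) ->
  brace_morph f.
Proof.
move=> fM fs genB lamB; split=> // b c.
have fD d x : f (d + s x)%R = (f d + std_gen x)%R.
  rewrite -[x in LHS](permKV (std_val (f d))) -lamB -circ_lambda fM fs.
  by rewrite std_add_gen.
have f0 : f 0%R = 0%R.
  have := fM circ_one circ_one; rewrite circ1b -{1}(circb1 (f _)).
  by move/circ_injl; rewrite !circ_one0.
have : c \in <<[set s x | x : X]>> by rewrite genB inE.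
case/gen_prodgP=> n [t tS ->].
elim: n => [|n IHn] in t tS *.
  by rewrite big_ord0 -[1%g]/(0%R : B) f0 !addr0.
rewrite big_ord_recr /=; have /imsetP[x _ ->] := tS ord_max.
have := IHn (fun i => t (widen_ord (leqnSn n) i)) (fun i => tS _).
set u := \prod_(i < n) _ => fu.
by rewrite -[(u * s x)%g]/(u + s x)%R addrA !fD fu addrA.
Qed.

(* Main.v *)
Require Import Defs.
From HB Require Import structures.
From mathcomp Require Import all_boot all_order all_fingroup all_algebra all_solvable.

Set Implicit Arguments.
Unset Strict Implicit.
Unset Printing Implicit Defensive.

Import GroupScope.

(* Write [g_x] for the generator [(sigma x)^-1]. The additive subgroup [L]
   spanned by the differences [g_x - g_y] is stable under [lambda], hence closed
   under [circ], and it is contained in the displacement group, because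
   [e + g_x = circ e g_w] and [e + g_y = circ e g_z] differ by
   [sigma_z sigma_w^-1]. By regularity [L] is thus a p-group, so all the [g_x]
   have the same p'-component [b]. As [lambda] permutes the [g_x], it fixes [b];
   hence the p'-part of the brace is the trivial brace on the cyclic group
   generated by [b], and it acts on the p-part by [lambda]. *)

(** * The maps [blambda x] in an arbitrary left brace *)

Section BraceFacts.
Variable B : leftBraceType.
Implicit Types x y z : B.

Lemma blambda_circ x y z : blambda (circ x y) z = blambda x (blambda y z).
Proof.
apply: (GRing.addrI (circ x y)); rewrite -circ_lambda -circA.
by rewrite (circ_lambda y) circ_lambda blambdaD GRing.addrA -circ_lambda.
Qed.

Lemma blambda1 y : blambda circ_one y = y.
Proof. by rewrite /blambda circ1b circ_one0 GRing.oppr0 GRing.add0r. Qed.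

Lemma blambda0 x : blambda x 0%R = 0%R.
Proof. by apply: (GRing.addrI (blambda x 0)%R); rewrite -blambdaD !GRing.addr0. Qed.

Lemma blambdaN x y : blambda x (- y)%R = (- blambda x y)%R.
Proof.
by apply: (GRing.addrI (blambda x y)); rewrite -blambdaD !GRing.subrr blambda0.
Qed.

Lemma blambda_bij x : bijective (blambda x).
Proof.
by exists (blambda (circ_inv x)) => y; rewrite -blambda_circ ?circVb ?circbV blambda1.
Qed.

(* If [lambda] fixes [c], then [circ (blambda c x) c = blambda c x + c = circ c x],
   so [blambda c] is conjugation by [c]. *)
Lemma blambda_fixed_morph c :
  (forall x, blambda x c = c) -> brace_morph (blambda c).
Proof.
move=> fixc; split=> [x y | x y]; first exact: blambdaD.
have conjE z : circ (blambda c z) c = circ c z.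
  by rewrite circ_lambda fixc GRing.addrC -circ_lambda.
(* Inserting [circ c (circ_inv c)] on the right of both sides lets [conjE] move [c] to the left past
   each factor. *)
rewrite -[LHS]circb1 -[RHS]circb1 -(circbV c) !circA; congr (circ _ _).
by rewrite conjE -circA conjE !circA conjE.
Qed.

End BraceFacts.

(** This is the form that [Morphism] expects, so that the theory of group morphisms applies to
    [blambda x]. *)
Lemma blambdaM (B : finLeftBraceType) (x : B) :
  {in [set: B] &, {morph (blambda x : B -> B) : y z / (y * z)%g}}.
Proof. by move=> y z _ _; apply: blambdaD. Qed.

(** * Trivial cyclic left braces of every positive order *)

Section CyclicBrace.
Variable n : nat.

(* ['I_n.+1] rather than ['Z_n], which is not trivial for [n = 1]. *)
Definition cyclic_brace_type : Type := 'I_n.+1.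
Local Notation T := cyclic_brace_type.

HB.instance Definition _ := Finite.copy T 'I_n.+1.
HB.instance Definition _ := GRing.Zmodule.copy T 'I_n.+1.

Fact cyclic_brace_circD (x y z : T) : (x + (y + z) + x = x + y + (x + z))%R.
Proof. by rewrite -!GRing.addrA; congr (_ + (_ + _))%R; rewrite GRing.addrC. Qed.

HB.instance Definition _ := Zmodule_isLeftBrace.Build T
  (@GRing.addrA T) (@GRing.add0r T) (@GRing.addNr T) cyclic_brace_circD.

Definition cyclic_brace : finLeftBraceType := T.

Lemma card_cyclic_brace : #|cyclic_brace| = n.+1.
Proof. exact: card_ord. Qed.

Lemma cyclic_braceP : cyclic_trivial_brace cyclic_brace.
Proof.
(* For [n = 0] this generator is zero, which still generates the one-element group. *)
split=> //; apply/cyclicP; exists (Zp1 : 'I_n.+1).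
exact: Zp_cycle.
Qed.

End CyclicBrace.

(** * Splitting off the cyclic group of a [blambda]-fixed p'-element *)

Section Decomposition.
Variables (B : finLeftBraceType) (p : nat) (P : {group B}).
Hypothesis sylP : p.-Sylow([set: B]) P.
Variable b : B.
Hypotheses (p'b : p^'.-elt (b : B)) (fixb : forall x, blambda x b = b).
Hypothesis spanb : forall x : B, x \in P * <[b]>.

Local Notation C := (cyclic_brace #[b].-1).

Definition cyc_emb (c : C) : B := b ^+ (c : 'I_#[b].-1.+1).

Lemma cyc_embD (c d : C) : cyc_emb (c + d)%R = (cyc_emb c + cyc_emb d)%R.
Proof.
rewrite -[RHS]/(cyc_emb c * cyc_emb d) /cyc_emb -expgD /=.
by apply: expg_mod; rewrite prednK ?order_gt0 ?expg_order.
Qed.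

Lemma fix_cyc_emb x c : blambda x (cyc_emb c) = cyc_emb c.
Proof.
rewrite /cyc_emb; elim: (nat_of_ord c) => [|i IHi]; first exact: blambda0.
by rewrite expgS -[b * _]/(b + _)%R blambdaD fixb IHi.
Qed.

Lemma circ_cyc_emb x c : circ x (cyc_emb c) = (x + cyc_emb c)%R.
Proof. by rewrite circ_lambda fix_cyc_emb. Qed.

Definition cyc_act (c : C) (u : sylow_brace sylP) : sylow_brace sylP :=
  Subg (lambda_addSylow sylP (cyc_emb c) (valP u)).

Lemma cyc_act_bij c : bijective (cyc_act c).
Proof.
apply: injF_bij => u v [/(bij_inj (blambda_bij _)) e].
exact: val_inj.
Qed.

Lemma cyc_act_morph c : brace_morph (cyc_act c).
Proof.
have [lamD lamM] := blambda_fixed_morph (fix_cyc_emb^~ c).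
by split=> u v; apply: val_inj; [apply: lamD | apply: lamM].
Qed.

(** Since [blambda] fixes the image of [cyc_emb], [circ] and addition agree there. *)
Lemma cyc_act_circ c d u : cyc_act (circ c d) u = cyc_act c (cyc_act d u).
Proof.
apply: val_inj => /=.
by rewrite -blambda_circ circ_cyc_emb -cyc_embD.
Qed.

Definition cyc_action := BraceAction cyc_act_bij cyc_act_morph cyc_act_circ.

Local Notation S := (sdbrace cyc_action).

Definition sd_val (x : S) : B := (sgval x.1 + cyc_emb x.2)%R.

Lemma sd_valD x y : sd_val (x + y)%R = (sd_val x + sd_val y)%R.
Proof. by rewrite /sd_val cyc_embD GRing.addrACA. Qed.

(** With [c], [d] identified with their images, [u + c = circ u c], while [circ c (v + d)] is
    [blambda c v + (c + d)], that is, [circ (blambda c v) (c + d)]. *)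
Lemma sd_val_circ x y : sd_val (circ x y) = circ (sd_val x) (sd_val y).
Proof.
case: x y => [u c] [v d]; rewrite /sd_val /=.
rewrite -(circ_cyc_emb (sgval u)) -circA (circ_lambda (cyc_emb c)).
rewrite blambdaD fix_cyc_emb GRing.addrCA -cyc_embD -circ_cyc_emb -circA.
by rewrite [in LHS]circ_cyc_emb.
Qed.

(** [P] and [<[b]>] have coprime orders, so they meet trivially. *)
Lemma sd_val_inj : injective sd_val.
Proof.
have tiPb : P :&: <[b]> = 1.
  by apply: coprime_TIg; apply: pnat_coprime (pHall_pgroup sylP) p'b.
move=> [u c] [v d]; rewrite /sd_val /= => e.
have uvb : (sgval v)^-1 * sgval u = cyc_emb d * (cyc_emb c)^-1.
  apply: (canRL (mulgK _)); rewrite -mulgA; apply: (canLR (mulKg _)).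
  exact: e.
have uv1 : (sgval v)^-1 * sgval u = 1.
  apply/set1gP; rewrite -tiPb inE groupM ?groupV ?subgP //= uvb.
  by rewrite groupM ?groupV ?mem_cycle.
have uv : u = v by apply: val_inj; rewrite /= -[sgval u](mulKVg (sgval v)) uv1 mulg1.
congr (_, _) => //; apply/val_inj/eqP.
have ltb (a : C) : (a : 'I_#[b].-1.+1) < #[b].
  by rewrite -[X in _ < X]prednK ?order_gt0 ?ltn_ord.
have := uv1; rewrite uvb => /(canRL (mulgK _))/eqP.
by rewrite mul1g invgK eq_sym eq_expg_mod_order !modn_small.
Qed.

Lemma sd_val_surj x : exists y, sd_val y = x.
Proof.
have /mulsgP[u _ uP /cycleP[i ->] ->] := spanb x.
exists (Subg uP : sylow_brace sylP, inord (i %% #[b]) : C).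
rewrite /sd_val /cyc_emb /= inordK ?expg_mod_order //.
by rewrite prednK ?order_gt0 ?ltn_mod.
Qed.

Lemma brace_isog_cyc_action : brace_isog B S.
Proof.
have [f fK] := fin_all_exists sd_val_surj.
exists f; first by exists sd_val => // x; apply: sd_val_inj; rewrite fK.
by split=> x y; apply: sd_val_inj; rewrite ?sd_valD ?sd_val_circ !fK.
Qed.

End Decomposition.

(** * Differences of generators and the displacement group *)

Section Displacement.
Variable X : finCycleSetType.
Local Notation D := (dis_group X).

Definition gen_diff : {set std_brace X} :=
  [set (std_gen x - std_gen y)%R | x : X, y : X].

Lemma dis_gens_sub : dis_gens X \subset D.
Proof. exact: subset_trans (sub_class_support _ _) (subset_gen _). Qed.

Lemma dis_add_gen_diff (g : std_brace X) d :
  std_val g \in D -> d \in gen_diff -> std_val (g + d)%R \in D.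
Proof.
move=> gD /imset2P[x y _ _ ->]; set e := (g - std_gen y)%R.
have -> : (g + (std_gen x - std_gen y) = e + std_gen x)%R.
  by rewrite /e GRing.addrAC GRing.addrA.
have eg : g = (e + std_gen y)%R by rewrite GRing.subrK.
move: gD; rewrite {1}eg !std_add_gen !std_val_circ !std_val_gen /Defs.pcomp.
set z := _ y; set w := _ x => gD.
(* Replacing [std_gen y] by [std_gen x] multiplies by an element of [dis_gens X]. *)
have -> : (csigma w)^-1 * std_val e =
    Defs.pcomp (csigma z) (csigma w)^-1 * ((csigma z)^-1 * std_val e).
  by rewrite /Defs.pcomp mulgA mulgK.
by rewrite groupM // (subsetP dis_gens_sub) //; apply: imset2_f.
Qed.

Lemma gen_diff_dis (g : std_brace X) : g \in <<gen_diff>> -> std_val g \in D.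
Proof.
case/gen_prodgP=> n [t tS ->].
elim: n => [|n IHn] in t tS *; first by rewrite big_ord0 group1.
rewrite big_ord_recr; apply: dis_add_gen_diff => //.
exact: (IHn (fun i => t (widen_ord (leqnSn n) i))).
Qed.

Lemma blambda_gen_diff (g h : std_brace X) :
  h \in <<gen_diff>> -> blambda g h \in <<gen_diff>>.
Proof.
move=> hL; have := mem_morphim (Morphism (@blambdaM _ g)) (in_setT h) hL.
rewrite morphim_gen ?subsetT //; apply/subsetP/genS/subsetP=> _ /morphimP[z _ zD ->].
have /imset2P[x y _ _ ->] := zD.
by rewrite /= blambdaD blambdaN !std_lambda; apply: imset2_f.
Qed.

(** [std_val] maps the additive span injectively onto a set closed under composition, hence onto a
    subgroup of the displacement group; Lagrange's theorem then applies. *)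
Lemma card_gen_diff : #|<<gen_diff>>| %| #|D|.
Proof.
have VG : group_set (@std_val X @: <<gen_diff>>).
  apply/group_setP; split=> [|_ _ /imsetP[g gL ->] /imsetP[h hL ->]].
    by apply/imsetP; exists 0%R => //; apply: group1.
  rewrite -[_ * _]std_val_circ; apply: imset_f; rewrite circ_lambda.
  by rewrite [(_ + _)%R \in _]groupM ?blambda_gen_diff.
rewrite -(card_imset _ (@std_val_inj X)); apply: (@cardSg _ D (group VG)).
by apply/subsetP=> _ /imsetP[g gL ->]; apply: gen_diff_dis.
Qed.

Lemma card_regular (x : X) : acts_regularly D -> #|D| = #|X|.
Proof.
case=> trD regD; rewrite -(card_orbit_stab 'P D x).
by rewrite (atransP trD) ?inE // regD cards1 muln1 cardsT.
Qed.

Variable p : nat.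
Hypothesis pD : p.-group D.

Lemma p_elt_gen_diff (x y : X) : p.-elt (std_gen x - std_gen y : std_brace X)%R.
Proof.
have pL : p.-group <<gen_diff>> by apply: pnat_dvd card_gen_diff pD.
by apply: mem_p_elt pL _; apply/mem_gen/imset2_f.
Qed.

Lemma std_gen_constt (x y : X) : (std_gen x).`_p^' = (std_gen y).`_p^'.
Proof.
have -> : std_gen x = (std_gen x - std_gen y : std_brace X)%R * std_gen y.
  by rewrite -[RHS]/(_ + _)%R GRing.subrK.
rewrite consttM; last exact: GRing.addrC.
set d := (_ - _)%R; suff /constt1P-> : p^'^'.-elt d by rewrite mul1g.
by rewrite /p_elt pnatNK; apply: p_elt_gen_diff.
Qed.

(** The additive morphism [blambda g] commutes with taking p'-components, and all generators share
    the same one. *)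
Lemma blambda_gen_constt (g : std_brace X) (x : X) :
  blambda g (std_gen x).`_p^' = (std_gen x).`_p^'.
Proof.
have := morph_constt (Morphism (@blambdaM _ g)) p^' (in_setT (std_gen x)).
by rewrite /= std_lambda (std_gen_constt _ x).
Qed.

Variable P : {group std_brace X}.
Hypothesis sylP : p.-Sylow([set: std_brace X]) P.

(** Each generator is the sum of its p-component, which lies in [P], and the common p'-component. *)
Lemma std_brace_span (x : X) (g : std_brace X) : g \in P * <[(std_gen x).`_p^']>.
Proof.
have abB (H K : {set std_brace X}) : H \subset 'C(K).
  by apply/centsP=> x1 _ x2 _; apply: GRing.addrC.
rewrite -cent_joinEr //; apply: (subsetP _ g (in_setT g)).
rewrite -std_generated gen_subG; apply/subsetP=> _ /imsetP[y _ ->].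
rewrite -(consttC p (std_gen y)) (std_gen_constt y x) groupM //.
  by rewrite (subsetP (joing_subl _ _)) // (mem_addSylow sylP) p_elt_constt.
by rewrite (subsetP (joing_subr _ _)) // cycle_id.
Qed.

End Displacement.

Theorem corollary37 (p k : nat) (X : finCycleSetType)
    (p_prime : prime p) (cardX : #|X| = (p ^ k)%N)
    (irrX : irretractable X)
    (regX : acts_regularly (dis_group X))
    (P : {group std_brace X})
    (sylP : p.-Sylow([set: std_brace X]) P) :
  exists (n : nat) (C : finLeftBraceType)
      (alpha : brace_action C (sylow_brace sylP)),
    [/\ coprime n p, #|C| = n, cyclic_trivial_brace C
      & brace_isog (std_brace X) (sdbrace alpha)].
Proof.
(* Any point serves: [b] below does not depend on it. *)
have [x] := @cycle_inhabited X.
have pD : p.-group (dis_group X).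
  by rewrite /pgroup (card_regular x regX) cardX pnatX pnat_id.
set b := (std_gen x).`_p^'.
have p'b : p^'.-elt b by apply: p_elt_constt.
have fixb g : blambda g b = b by apply: blambda_gen_constt.
have spanb g : g \in P * <[b]> by apply: std_brace_span.
exists #[b], (cyclic_brace #[b].-1), (cyc_action sylP fixb); split.
- by rewrite coprime_sym (pnat_coprime (pnat_id p_prime)).
- by rewrite card_cyclic_brace prednK ?order_gt0.
- exact: cyclic_braceP.
- exact: brace_isog_cyc_action.
Qed.
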